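(* Let $W:\mathrm{GL}^+(2)\to\mathbb{R}$ be an objective, isotropic and isochoric function and let $f,\widetilde f:[0,\infty)\to\mathbb{R}$ denote the uniquely determined functions with $$W(F)=\widetilde f\left(\|\mathrm{dev}_2\log U\|^2\right)=f\left(\log^2\frac{\lambda_1}{\lambda_2}\right)$$ for all $F\in\mathrm{GL}^+(2)$ with singular values $\lambda_1,\lambda_2$, where $U=\sqrt{F^TF}$. If $f,\widetilde f\in C^2([0,\infty))$, then the following are equivalent: (i) $W$ is polyconvex; (ii) $W$ is rank-one convex; (iii) $2\,\theta\,f''(\theta)+(1-\sqrt{\theta})\,f'(\theta)\ge0$ for all $\theta\in(0,\infty)$; (iv) $2\,\eta\,\widetilde f''(\eta)+(1-\sqrt{2\eta})\,\widetilde f'(\eta)\ge0$ for all $\eta\in(0,\infty)$.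
   Context: $\mathrm{GL}^+(2)=\{X\in\mathbb{R}^{2\times2} : \det X>0\}$; $\mathrm{SO}(2)$ is the special orthogonal group. A function $W:\mathrm{GL}^+(2)\to\mathbb{R}$ is objective and isotropic if $W(Q_1FQ_2)=W(F)$ for all $F\in\mathrm{GL}^+(2)$ and $Q_1,Q_2\in\mathrm{SO}(2)$; it is isochoric if $W(aF)=W(F)$ for all $F\in\mathrm{GL}^+(2)$ and all $a>0$. $\log U$ is the principal matrix logarithm of the symmetric positive definite matrix $U=\sqrt{F^TF}$, $\mathrm{dev}_2X=X-\frac12\mathrm{tr}(X)\cdot I$ is the deviatoric part of $X\in\mathbb{R}^{2\times2}$ ($I$ the identity matrix), and $\|\cdot\|$ is the Frobenius norm. $\log^2 x$ means $(\log x)^2$. For every objective, isotropic and isochoric $W$ the functions $f,\widetilde f$ exist and are unique. $C^2([0,\infty))$ is understood with one-sided derivatives at $0$. $W$ is polyconvex if there is a convex function $P:\mathbb{R}^{2\times2}\times\mathbb{R}\to\mathbb{R}\cup\{+\infty\}$ with $W(F)=P(F,\det F)$ for all $F\in\mathrm{GL}^+(2)$. $W$ is rank-one convex (on $\mathrm{GL}^+(2)$) if $W(F+(1-\theta)\,\xi\otimes\eta)\le\theta W(F)+(1-\theta)W(F+\xi\otimes\eta)$ for all $F\in\mathrm{GL}^+(2)$, $\theta\in[0,1]$ and all $\xi,\eta\in\mathbb{R}^2$ such that $F+t\,\xi\otimes\eta\in\mathrm{GL}^+(2)$ for all $t\in[0,1]$, where $\xi\otimes\eta=\xi\eta^T$.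 *)

(* Defs.v *)
From HB Require Import structures.
From mathcomp Require Import all_boot all_order all_algebra.
From mathcomp Require Import all_classical all_reals all_analysis.

Set Implicit Arguments.
Unset Strict Implicit.
Unset Printing Implicit Defensive.

Import Order.TTheory GRing.Theory Num.Theory.
Import numFieldNormedType.Exports.

Local Open Scope ring_scope.
Local Open Scope classical_set_scope.

Definition GLp2 (R : realType) (F : 'M[R]_2) : Prop := 0 < \det F.

Definition SO2 (R : realType) (Q : 'M[R]_2) : Prop :=
  Q^T *m Q = 1%:M /\ \det Q = 1.

(* Energies are total functions on 2x2 matrices; every property below
   constrains them on [GLp2] only. *)
Definition objective_isotropic (R : realType) (W : 'M[R]_2 -> R) : Prop :=
  forall F Q1 Q2, GLp2 F -> SO2 Q1 -> SO2 Q2 -> W (Q1 *m F *m Q2) = W F.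

Definition isochoric (R : realType) (W : 'M[R]_2 -> R) : Prop :=
  forall F (a : R), GLp2 F -> 0 < a -> W (a *: F) = W F.

(* The singular values of F, listed with multiplicity: the nonnegative square
   roots of the eigenvalues of F^T F. *)
Definition singular_values2 (R : realType) (F : 'M[R]_2) (l1 l2 : R) : Prop :=
  [/\ 0 <= l1, 0 <= l2 &
      char_poly (F^T *m F) = ('X - (l1 ^+ 2)%:P) * ('X - (l2 ^+ 2)%:P)].

Definition posdefmx (R : realType) (n : nat) (A : 'M[R]_n) : Prop :=
  A^T = A /\ forall x : 'cV[R]_n, x != 0 -> 0 < (x^T *m A *m x) 0 0.

(* The positive definite square root (0 if there is none). *)
Definition sqrtm (R : realType) (n : nat) (A : 'M[R]_n) : 'M[R]_n :=
  xget 0 [set U | posdefmx U /\ U *m U = A].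

(* L is the principal logarithm of the symmetric positive definite matrix U:
   U and L have a common orthonormal eigenbasis, and the eigenvalues of L are
   the real logarithms of the (positive) eigenvalues of U. *)
Definition is_logm (R : realType) (n : nat) (U L : 'M[R]_n) : Prop :=
  exists (Q : 'M[R]_n) (d : 'rV[R]_n),
    [/\ Q^T *m Q = 1%:M, forall i, 0 < d 0 i,
        U = Q *m diag_mx d *m Q^T &
        L = Q *m diag_mx (map_mx (@ln R) d) *m Q^T].

Lemma is_logm_uniq (R : realType) (n : nat) (U L L' : 'M[R]_n) :
  is_logm U L -> is_logm U L' -> L = L'.
Proof.
move=> [Q [d [QQ d0 UE ->]]] [P [e [PP e0 UE' ->]]].
have QQ' := mulmx1C QQ; have PP' := mulmx1C PP.
pose M := P^T *m Q.
have MM : M *m diag_mx d = diag_mx e *m M.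
  have := congr1 (fun X => P^T *m X *m Q) (etrans (esym UE) UE').
  by rewrite /M !mulmxA -!mulmxA QQ mulmx1 (mulmxA P^T P) PP mul1mx.
suff ML : M *m diag_mx (map_mx (@ln R) d) = diag_mx (map_mx (@ln R) e) *m M.
  have := congr1 (fun X => P *m X *m Q^T) ML.
  by rewrite /M !mulmxA PP' mul1mx -!mulmxA QQ' mulmx1.
apply/matrixP => i j; have /matrixP/(_ i j) := MM.
rewrite !mul_mx_diag !mul_diag_mx !mxE.
set m := \sum_k _; have [->|m0] := eqVneq m 0; first by rewrite !mul0r !mulr0.
by rewrite mulrC => /(mulIf m0) ->; rewrite mulrC.
Qed.

(* 0 if U is not symmetric positive definite. *)
Definition logm (R : realType) (n : nat) (U : 'M[R]_n) : 'M[R]_n :=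
  xget 0 [set L | is_logm U L].

Definition dev2 (R : realType) (X : 'M[R]_2) : 'M[R]_2 :=
  X - (2^-1 * \tr X) *: 1%:M.

(* The library's norm on matrices is the sup norm, not this one. *)
Definition frobenius_norm (R : realType) (m n : nat) (X : 'M[R]_(m, n)) : R :=
  Num.sqrt (\sum_i \sum_j X i j ^+ 2).

(* g is the derivative of f on [0, +oo[: the difference quotients are
   restricted to [0, +oo[, so the derivative is one-sided at 0 and the usual
   one at every x > 0. *)
Definition is_derive_ge0 (R : realType) (f g : R -> R) : Prop :=
  forall x : R, 0 <= x ->
    (fun y : R => (f y - f x) / (y - x)) @ within `[0, +oo[ x^' --> g x.

(* f, of which only the values on [0, +oo[ matter, is of class C^2 there. *)
Definition C2_ge0 (R : realType) (f : R -> R) : Prop :=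
  exists f1 f2 : R -> R,
    [/\ is_derive_ge0 f f1, is_derive_ge0 f1 f2 &
        {within `[0, +oo[, continuous f2}].

(* Convexity of a function with values in R U {+oo}. Since 0 * +oo = 0 in
   \bar R, the inequality is trivially true for t = 0 and t = 1. *)
Definition convex_pinfty (R : realType) (V : lmodType R) (P : V -> \bar R) :
    Prop :=
  (forall x, P x != -oo%E) /\
  forall (x y : V) (t : R), 0 <= t <= 1 ->
    (P (t *: x + (1 - t) *: y)%R <= t%:E * P x + (1 - t)%R%:E * P y)%E.

Definition polyconvex (R : realType) (W : 'M[R]_2 -> R) : Prop :=
  exists2 P : 'M[R]_2 * R^o -> \bar R, convex_pinfty P &
    forall F, GLp2 F -> (W F)%:E = P (F, \det F).

Definition rank_one_convex (R : realType) (W : 'M[R]_2 -> R) : Prop :=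
  forall (F : 'M[R]_2) (xi eta : 'cV[R]_2) (theta : R),
    GLp2 F -> 0 <= theta <= 1 ->
    (forall t, 0 <= t <= 1 -> GLp2 (F + t *: (xi *m eta^T))) ->
    W (F + (1 - theta) *: (xi *m eta^T)) <=
      theta * W F + (1 - theta) * W (F + xi *m eta^T).

(* Main.v *)
(* Writing [h x = f (ln x ^ 2)], the energy is [W F = h (M ^ 2 / det F)], where
   [M] is the largest singular value of [F]: indeed [l1 / l2 = l1 ^ 2 / (l1 * l2)].
   For [x > 1], [h'' x] is [2 / x ^ 2] times the expression in (iii) at
   [theta = ln x ^ 2].  Rank-one convexity along the diagonal matrices
   [diag (x, 1)] makes [h] convex on [(0, +oo)], hence (iii).  Conversely, (iii)
   makes [h] convex on [[1, +oo)], and since [h' 1 = 0] it is nondecreasing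
   there, so that [x |-> h (max x 1)] is convex and nondecreasing on the whole
   line.  Composing it with the jointly convex function
   [(F, d) |-> M F ^ 2 / d] gives the polyconvex representation of [W].  Finally
   [f s = ft (s / 2)], because [dev2 (log diag (x, 1))] is
   [diag (ln x / 2, - ln x / 2)]. *)
Require Import Defs.
From mathcomp Require Import all_boot all_order all_algebra.
From mathcomp Require Import all_classical all_reals all_analysis.
From mathcomp Require Import ring lra.

Set Implicit Arguments.
Unset Strict Implicit.
Unset Printing Implicit Defensive.

Import Order.TTheory GRing.Theory Num.Theory.
Import numFieldNormedType.Exports.

Local Open Scope ring_scope.
Local Open Scope classical_set_scope.

(** * Derivatives, one-sided or not, as first-order estimates without division *)

Lemma is_derive_ge0_dist (R : realType) (f g : R -> R) (x e : R) :
  is_derive_ge0 f g -> 0 <= x -> 0 < e ->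
  exists2 d, 0 < d & forall y, 0 <= y -> `|y - x| < d ->
    `|f y - f x - g x * (y - x)| <= e * `|y - x|.
Proof.
move=> fg x0 e0; have /cvgrPdist_lt/(_ e e0) := fg x x0.
case=> d /= d0 dP; exists d => // y y0 yx.
have [->|yNx] := eqVneq y x; first by rewrite !subrr mulr0 subr0 normr0 mulr0.
have := dP y; rewrite /= in_itv/= y0 andbT distrC => /(_ yx yNx erefl).
rewrite distrC => /ltW le_e.
have yx0 : y - x != 0 by rewrite subr_eq0.
have -> : f y - f x - g x * (y - x) = ((f y - f x) / (y - x) - g x) * (y - x).
  by rewrite mulrBl divfK.
by rewrite normrM ler_wpM2r.
Qed.

Lemma is_derive1_dist (R : realType) (f : R -> R) (x l e : R) :
  is_derive x 1 f l -> 0 < e ->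
  exists2 d, 0 < d & forall y, `|y - x| < d ->
    `|f y - f x - l * (y - x)| <= e * `|y - x|.
Proof.
move=> [df <-] e0; have /cvgrPdist_lt/(_ e e0) := df.
case=> d /= d0 dP; exists d => // y yx.
have [->|yNx] := eqVneq y x; first by rewrite !subrr mulr0 subr0 normr0 mulr0.
have yx0 : y - x != 0 by rewrite subr_eq0.
have := dP (y - x); rewrite /= sub0r normrN => /(_ yx yx0).
rewrite [_ *: 1]mulr1 subrK distrC => /ltW le_e.
have -> : f y - f x - 'D_1 f x * (y - x) =
    ((y - x)^-1 * (f y - f x) - 'D_1 f x) * (y - x).
  by rewrite mulrBl mulrAC mulVf// mul1r.
by rewrite normrM ler_wpM2r.
Qed.

Lemma dist_is_derive1 (R : realType) (f : R -> R) (x l : R) :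
  (forall e, 0 < e -> exists2 d, 0 < d & forall y, `|y - x| < d ->
    `|f y - f x - l * (y - x)| <= e * `|y - x|) ->
  is_derive x 1 f l.
Proof.
move=> fP.
suff H : h^-1 *: ((f \o shift x) (h *: 1) - f x) @[h --> 0^'] --> l.
  apply: DeriveDef; first by apply/cvg_ex; exists l.
  exact: (cvg_lim _ H).
apply/cvgrPdist_le => e e0; have [d d0 dP] := fP e e0.
exists d => // h /=; rewrite sub0r normrN => hd h0.
have := dP (h + x); rewrite addrK => /(_ hd) le_e.
rewrite [h *: 1]mulr1 distrC -(ler_pM2r (_ : 0 < `|h|)) ?normr_gt0//.
by rewrite -normrM mulrBl mulrAC (mulVf h0) mul1r.
Qed.

Lemma is_derive_ge0_is_derive (R : realType) (f g : R -> R) (x : R) :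
  is_derive_ge0 f g -> 0 < x -> is_derive x 1 f (g x).
Proof.
move=> fg x0; apply: dist_is_derive1 => e e0.
have [d d0 dP] := is_derive_ge0_dist fg (ltW x0) e0.
(* A radius of at most [x] keeps [y] nonnegative, where the one-sided estimate applies. *)
exists (Num.min d x); first by rewrite lt_min d0.
move=> y; rewrite lt_min => /andP[yd yx]; apply: dP => //.
by move: yx; rewrite ltr_norml => /andP[? _]; lra.
Qed.

(** Squares stay in the half-line, so the one-sided derivative at [0] gives two-sided continuity
    even at [s = 0]; with [s = ln x] this is the point [x = 1]. *)
Lemma is_derive_ge0_continuous_sqr (R : realType) (f g : R -> R) :
  is_derive_ge0 f g -> continuous (fun s : R => f (s ^+ 2)).
Proof.
move=> fg s; apply/cvgrPdist_le => e e0.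
have [d d0 dP] := is_derive_ge0_dist fg (sqr_ge0 s) ltr01.
(* Tolerance 1 in the first-order estimate makes [c] bound the increments of [f] from [s ^+ 2]. *)
pose c := 1 + `|g (s ^+ 2)|.
have c0 : 0 < c by rewrite ltr_pwDl.
have : \forall t \near (s : R), `|s ^+ 2 - t ^+ 2| < Num.min d (e / c).
  have /cvgrPdist_lt : (fun t : R => t ^+ 2) @ s --> s ^+ 2 by exact: exprn_continuous.
  by apply; rewrite lt_min d0 divr_gt0.
apply: filterS => t; rewrite lt_min distrC => /andP[td te].
have tP := dP _ (sqr_ge0 t) td.
rewrite distrC.
have -> : f (t ^+ 2) - f (s ^+ 2) =
  (f (t ^+ 2) - f (s ^+ 2) - g (s ^+ 2) * (t ^+ 2 - s ^+ 2)) +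
  g (s ^+ 2) * (t ^+ 2 - s ^+ 2) by ring.
apply: (le_trans (ler_normD _ _)); rewrite normrM.
apply: (@le_trans _ _ (c * `|t ^+ 2 - s ^+ 2|)).
  by rewrite mulrDl lerD2r.
by rewrite mulrC -ler_pdivlMr// ltW.
Qed.

(** * Convexity of functions of one real variable *)

Lemma is_derive1_ge_slope (R : realType) (f : R -> R) (x l c d : R) :
  is_derive x 1 f l -> 0 < d ->
  (forall s, 0 < s < d -> c * s <= f (x + s) - f x) -> c <= l.
Proof.
move=> fl d0 fc; apply/ler_addgt0Pr => e e0.
have [d' d'0 d'P] := is_derive1_dist fl e0.
pose s := Num.min d d' / 2.
have m0 : 0 < Num.min d d' by rewrite lt_min d0.
have [sd sd'] : s < d /\ s < d'.
  have : s < Num.min d d' by rewrite /s; lra.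
  by rewrite lt_min => /andP[].
have s0 : 0 < s by rewrite divr_gt0.
have := fc s; rewrite s0 sd => /(_ erefl) cs.
have := d'P (x + s); rewrite (addrC x) addrK (gtr0_norm s0) => /(_ sd').
rewrite ler_norml => /andP[_]; rewrite (addrC s) => le_e.
rewrite -(ler_pM2r s0); lra.
Qed.

(** The chord inequality bounds the difference quotients of [h] along the segment by [h y - h x].
    Signs are flipped to get the lower bound that [is_derive1_ge_slope] handles. *)
Lemma convex_tangent (R : realType) (h : R -> R) (x y l : R) :
  (forall t, 0 <= t <= 1 -> h (x + t * (y - x)) <= (1 - t) * h x + t * h y) ->
  is_derive x 1 h l -> l * (y - x) <= h y - h x.
Proof.
move=> hc hl; rewrite -lerN2 -mulNr.
have hk : is_derive (0 : R) 1 (fun t : R => - h (x + t * (y - x))) (- (l * (y - x))).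
  have hl' : is_derive (x + 0 * (y - x)) 1 h l by rewrite mul0r addr0.
  have da : is_derive (0 : R) 1 (fun t : R => x + t * (y - x)) (y - x).
    apply: dist_is_derive1 => e e0; exists 1 => // t _.
    rewrite [X in `|X|](_ : _ = 0) ?normr0; last by ring.
    by rewrite mulr_ge0// ltW.
  have := @is_derive1_comp _ h (fun t : R => x + t * (y - x)) 0 _ _ hl' da.
  exact: is_deriveN.
rewrite mulNr; apply: (is_derive1_ge_slope hk ltr01) => s /andP[s0 s1].
have := hc s; rewrite (ltW s0) (ltW s1) => /(_ erefl).
by rewrite add0r mul0r addr0; lra.
Qed.

(** Adding the tangent inequalities at [x] and at [x + s] gives [g x <= g (x + s)]. *)
Lemma convex_second_derive_ge0 (R : realType) (h g : R -> R) (a x l : R) :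
  (forall y z t, a < y -> a < z -> 0 <= t <= 1 ->
    h (y + t * (z - y)) <= (1 - t) * h y + t * h z) ->
  (forall y, a < y -> is_derive y 1 h (g y)) ->
  a < x -> is_derive x 1 g l -> 0 <= l.
Proof.
move=> hc hg ax gl; apply: (is_derive1_ge_slope gl ltr01) => s /andP[s0 _].
have axs : a < x + s by lra.
have t1 := convex_tangent (fun t => hc x (x + s) t ax axs) (hg _ ax).
have t2 := convex_tangent (fun t => hc (x + s) x t axs ax) (hg _ axs).
rewrite mul0r -(ler_pM2r s0) mul0r.
have : g x * s <= g (x + s) * s by move: t1 t2; lra.
by rewrite mulrBl; lra.
Qed.

(** The mean value theorem for [g] makes it nondecreasing, then for [h] gives the tangent lines.
    Only continuity is asked at [a]: for the profile at [x = 1], the one-sided derivative of [f] at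
    [0] blocks the usual chain rule. *)
Lemma second_derive_ge0_tangent (R : realType) (a : R) (h g g2 : R -> R) :
  (forall x, a <= x -> {for x, continuous h}) ->
  (forall x, a <= x -> {for x, continuous g}) ->
  (forall x, a < x -> is_derive x 1 h (g x)) ->
  (forall x, a < x -> is_derive x 1 g (g2 x)) ->
  (forall x, a < x -> 0 <= g2 x) -> g a = 0 ->
  [/\ forall x, a <= x -> 0 <= g x &
      forall x y, a <= x -> a <= y -> h x + g x * (y - x) <= h y].
Proof.
move=> ch cg hg gg2 g20 ga.
have mvt (u v : R -> R) x y : (forall z, a <= z -> {for z, continuous u}) ->
    (forall z, a < z -> is_derive z 1 u (v z)) -> a <= x -> x < y ->
    exists2 c, x < c < y & u y - u x = v c * (y - x).
  move=> cu uv ax xy; have [||c] := @MVT _ u v x y xy.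
  - by move=> z; rewrite in_itv/= => /andP[xz _]; apply: uv; exact: le_lt_trans xz.
  - apply: continuous_in_subspaceT => z; rewrite inE/= in_itv/= => /andP[xz _].
    by apply: cu; exact: le_trans xz.
  - by rewrite in_itv/=; exists c.
have gmono x y : a <= x -> x <= y -> g x <= g y.
  move=> ax; rewrite le_eqVlt => /predU1P[->//|xy].
  have [c /andP[xc cy] E] := mvt g g2 x y cg gg2 ax xy.
  rewrite -subr_ge0 E mulr_ge0//; last by rewrite subr_ge0 ltW.
  by apply: g20; exact: le_lt_trans xc.
split=> [x ax|x y ax ay]; first by rewrite -ga gmono.
have [xy|yx|->] := ltgtP x y; last by rewrite subrr mulr0 addr0.
- have [c /andP[xc cy] E] := mvt h g x y ch hg ax xy.
  have : g x * (y - x) <= g c * (y - x).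
    by rewrite ler_pM2r ?subr_gt0// gmono// ltW.
  lra.
- have [c /andP[xc cy] E] := mvt h g y x ch hg ay yx.
  have : g c * (x - y) <= g x * (x - y).
    by rewrite ler_pM2r ?subr_gt0// gmono ?(ltW cy)// ltW// (le_lt_trans ay).
  lra.
Qed.

(** As [g a = 0], continuing [h] by the constant [h a] to the left of [a] keeps the tangent lines
    below the graph. Supporting lines everywhere give convexity, and their nonnegative slopes give
    monotonicity. *)
Lemma second_derive_ge0_clamp (R : realType) (a : R) (h g g2 : R -> R) :
  (forall x, a <= x -> {for x, continuous h}) ->
  (forall x, a <= x -> {for x, continuous g}) ->
  (forall x, a < x -> is_derive x 1 h (g x)) ->
  (forall x, a < x -> is_derive x 1 g (g2 x)) ->
  (forall x, a < x -> 0 <= g2 x) -> g a = 0 ->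
  let k x := h (Num.max x a) in
  {homo k : x y / x <= y} /\
  forall x y t, 0 <= t <= 1 ->
    k (t * x + (1 - t) * y) <= t * k x + (1 - t) * k y.
Proof.
move=> ch cg hg gg2 g20 ga k.
have [g0 tangent] := second_derive_ge0_tangent ch cg hg gg2 g20 ga.
have gM0 x : 0 <= g (Num.max x a) by rewrite g0// le_max lexx orbT.
have ktangent x y : k x + g (Num.max x a) * (y - x) <= k y.
  have := tangent (Num.max x a) (Num.max y a).
  rewrite !le_max !lexx !orbT => /(_ erefl erefl); apply: le_trans.
  (* Left of [a] the slope is [g a = 0]; beyond [a], clamping fixes [x] and can only increase
     [y]. *)
  rewrite lerD2l; case: (leP x a) => [xa|ax]; first by rewrite ga !mul0r.
  apply: ler_wpM2l; first by rewrite g0// ltW.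
  by rewrite lerD2r le_max lexx.
split=> [x y xy|x y t /andP[t0 t1]].
  by apply: le_trans (ktangent x y); rewrite lerDl mulr_ge0// subr_ge0.
(* The supporting line at [z], averaged over [x] and [y] with weights [t] and [1 - t], takes the
   value [k z]. *)
set z := t * x + (1 - t) * y; set G := g (Num.max z a).
have := ler_wpM2l t0 (ktangent z x).
have : 0 <= 1 - t by rewrite subr_ge0.
move=> /ler_wpM2l/(_ _ _ (ktangent z y)).
rewrite -/G => A B.
suff -> : k z = t * (k z + G * (x - z)) + (1 - t) * (k z + G * (y - z)).
  exact: lerD.
by rewrite /z; ring.
Qed.

(** * Library derivatives, and the first two derivatives of the logarithmic profile *)

Lemma is_derive_ge0_derive1 (R : realType) (f g : R -> R) (x : R) :
  is_derive_ge0 f g -> 0 < x -> f^`() x = g x.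
Proof.
by move=> fg x0; have [_ <-] := is_derive_ge0_is_derive fg x0; rewrite derive1E.
Qed.

Lemma is_derive_ge0_derive2 (R : realType) (f f1 f2 : R -> R) (x : R) :
  is_derive_ge0 f f1 -> is_derive_ge0 f1 f2 -> 0 < x -> f^`(2) x = f2 x.
Proof.
move=> ff1 f12 x0; rewrite /derive1n/= -(is_derive_ge0_derive1 f12 x0) !derive1E.
apply: near_eq_derive.
near=> y; apply: is_derive_ge0_derive1 => //; near: y.
exact: lt_nbhsr.
Unshelve. all: by end_near. Qed.

Definition log2_profile (R : realType) (f : R -> R) (x : R) := f (ln x ^+ 2).

Definition dlog2_profile (R : realType) (f1 : R -> R) (x : R) :=
  f1 (ln x ^+ 2) * (2 * ln x / x).

Definition ddlog2_profile (R : realType) (f1 f2 : R -> R) (x : R) :=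
  2 / x ^+ 2 *
    (2 * ln x ^+ 2 * f2 (ln x ^+ 2) + (1 - ln x) * f1 (ln x ^+ 2)).

Lemma continuous_log2_profile (R : realType) (f f1 : R -> R) (x : R) :
  is_derive_ge0 f f1 -> 0 < x -> {for x, continuous (log2_profile f)}.
Proof.
move=> ff1 x0; apply: (@continuous_comp _ _ _ (@ln R) (fun s : R => f (s ^+ 2))).
  exact: continuous_ln.
exact: (is_derive_ge0_continuous_sqr ff1).
Qed.

Lemma continuous_dlog2_profile (R : realType) (f1 f2 : R -> R) (x : R) :
  is_derive_ge0 f1 f2 -> 0 < x -> {for x, continuous (dlog2_profile f1)}.
Proof.
move=> f12 x0; apply: continuousM; first exact: (continuous_log2_profile f12).
apply: continuousM; last by apply: continuousV; [rewrite gt_eqF|exact: cvg_id].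
by apply: continuousM; [exact: cvg_cst|exact: continuous_ln].
Qed.

Lemma is_derive_log2 (R : realType) (x : R) : 0 < x ->
  is_derive x 1 (fun y : R => ln y ^+ 2) (2 * ln x / x).
Proof.
move=> x0; have lnd := is_derive1_ln x0.
apply: is_derive_eq; rewrite /GRing.scale/=. lra.
Qed.

(** For [1 < x] the argument [ln x ^+ 2] is positive, where the derivative of [f] is two-sided. *)
Lemma is_derive_log2_profile (R : realType) (f f1 : R -> R) (x : R) :
  is_derive_ge0 f f1 -> 1 < x ->
  is_derive x 1 (log2_profile f) (dlog2_profile f1 x).
Proof.
move=> ff1 x1; have x0 : 0 < x by lra.
have l0 : 0 < ln x ^+ 2 by rewrite exprn_gt0// ln_gt0.
exact: (@is_derive1_comp _ f (fun y : R => ln y ^+ 2) x _ _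
  (is_derive_ge0_is_derive ff1 l0) (is_derive_log2 x0)).
Qed.

Lemma is_derive_dlog2_profile (R : realType) (f1 f2 : R -> R) (x : R) :
  is_derive_ge0 f1 f2 -> 1 < x ->
  is_derive x 1 (dlog2_profile f1) (ddlog2_profile f1 f2 x).
Proof.
move=> f12 x1; have x0 : 0 < x by lra.
have x0' : x != 0 by rewrite gt_eqF.
have d1 := is_derive_log2_profile f12 x1.
have lnd := is_derive1_ln x0.
have vd : is_derive x 1 (fun y : R => y^-1) (- x ^- 2).
  apply: is_derive_eq (is_deriveV x0' (is_derive_id x 1)) _.
  by rewrite /GRing.scale/= mulr1.
have d2 : is_derive x 1 (fun y : R => 2 * ln y / y) (2 * (1 - ln x) / x ^+ 2).
  have d3 : is_derive x 1 (fun y : R => 2 * ln y) (2 * x^-1).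
    exact: (@is_deriveZ _ _ _ (@ln R) 2 x 1 _ lnd).
  apply: is_derive_eq (is_deriveM d3 vd) _.
  by rewrite /GRing.scale/=; field.
apply: is_derive_eq (is_deriveM d1 d2) _.
by rewrite /GRing.scale/= /ddlog2_profile /dlog2_profile /log2_profile; field.
Qed.

(** The factor [ln x] makes the first derivative vanish at [x = 1] whatever [f1 0] is, which allows
    clamping there. *)
Lemma log2_profile_clamp (R : realType) (f f1 f2 : R -> R) :
  is_derive_ge0 f f1 -> is_derive_ge0 f1 f2 ->
  (forall theta, 0 < theta ->
    0 <= 2 * theta * f2 theta + (1 - Num.sqrt theta) * f1 theta) ->
  let k x := log2_profile f (Num.max x 1) in
  {homo k : x y / x <= y} /\
  forall x y t, 0 <= t <= 1 ->
    k (t * x + (1 - t) * y) <= t * k x + (1 - t) * k y.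
Proof.
move=> ff1 f12 cond.
apply: (@second_derive_ge0_clamp _ 1 _ (dlog2_profile f1) (ddlog2_profile f1 f2)).
- by move=> x x1; apply: continuous_log2_profile ff1 _; lra.
- by move=> x x1; apply: continuous_dlog2_profile f12 _; lra.
- by move=> x; exact: is_derive_log2_profile.
- by move=> x; exact: is_derive_dlog2_profile.
- move=> x x1; have lnx : 0 < ln x by rewrite ln_gt0.
  have := cond (ln x ^+ 2); rewrite exprn_gt0// sqrtr_sqr gtr0_norm// => /(_ erefl).
  by apply: mulr_ge0; rewrite divr_ge0// sqr_ge0.
- by rewrite /dlog2_profile ln1 mulr0 mul0r mulr0.
Qed.

(** The second derivative is read off at [expR (Num.sqrt theta)], the point beyond 1 whose squared
    logarithm is [theta]. *)
Lemma convex_log2_profile (R : realType) (f f1 f2 : R -> R) (theta : R) :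
  is_derive_ge0 f f1 -> is_derive_ge0 f1 f2 ->
  (forall y z t, 0 < y -> 0 < z -> 0 <= t <= 1 ->
    log2_profile f (y + t * (z - y)) <=
      (1 - t) * log2_profile f y + t * log2_profile f z) ->
  0 < theta -> 0 <= 2 * theta * f2 theta + (1 - Num.sqrt theta) * f1 theta.
Proof.
move=> ff1 f12 hc theta0.
have s0 : 0 < Num.sqrt theta by rewrite sqrtr_gt0.
have x1 : 1 < expR (Num.sqrt theta) by rewrite expR_gt1.
have : 0 <= ddlog2_profile f1 f2 (expR (Num.sqrt theta)).
  apply: (convex_second_derive_ge0 (h := log2_profile f) _ _ x1
    (is_derive_dlog2_profile f12 x1)) => [y z t y1 z1|y].
    by apply: hc; lra.
  exact: is_derive_log2_profile.
rewrite /ddlog2_profile expRK sqr_sqrtr; last exact: ltW.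
by rewrite pmulr_rge0// divr_gt0// exprn_gt0// expR_gt0.
Qed.

(** The factor [c] permits iteration: the conclusion for [c = 1] is the hypothesis for the next
    derivatives, with [c = 1 / 2]. *)
Lemma is_derive_ge0_half (R : realType) (f g f1 g1 : R -> R) (c : R) :
  is_derive_ge0 f f1 -> is_derive_ge0 g g1 ->
  (forall x, 0 < x -> f x = c * g (x / 2)) ->
  forall x, 0 < x -> f1 x = c / 2 * g1 (x / 2).
Proof.
move=> ff1 gg1 fg x x0.
have x20 : 0 < x / 2 by rewrite divr_gt0.
rewrite -(is_derive_ge0_derive1 ff1 x0) derive1E.
have hd : is_derive x 1 (fun y : R => y / 2) 2^-1.
  apply: dist_is_derive1 => e e0; exists 1 => // y _.
  rewrite [X in `|X|](_ : _ = 0) ?normr0; last by ring.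
  by rewrite mulr_ge0// ltW.
have gd := @is_derive1_comp _ g (fun y : R => y / 2) x _ _
  (is_derive_ge0_is_derive gg1 x20) hd.
have [_ E] := @is_deriveZ _ _ _ _ c x 1 _ gd.
rewrite mulrAC -mulrA -[RHS]E; apply: near_eq_derive.
by near=> y; rewrite fg//; near: y; exact: lt_nbhsr.
Unshelve. all: by end_near. Qed.

(** * Matrices of size 2; square root and logarithm of diagonal ones *)

Lemma sum_ord2 (V : nmodType) (F : 'I_2 -> V) : \sum_i F i = F 0 + F 1.
Proof. by rewrite big_ord_recl big_ord1; congr (_ + F _); exact/val_inj. Qed.

Lemma matrix2P (T : Type) (A B : 'M[T]_2) :
  A 0 0 = B 0 0 -> A 0 1 = B 0 1 -> A 1 0 = B 1 0 -> A 1 1 = B 1 1 -> A = B.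
Proof.
move=> e00 e01 e10 e11.
have I2 (i : 'I_2) : i = 0 \/ i = 1.
  by case: i => -[|[|//]] ?; [left|right]; exact/val_inj.
by apply/matrixP => i j; case: (I2 i) => ->; case: (I2 j) => ->.
Qed.

Lemma det_mx2 (R : comNzRingType) (A : 'M[R]_2) :
  \det A = A 0 0 * A 1 1 - A 0 1 * A 1 0.
Proof.
rewrite (expand_det_row _ 0) sum_ord2 /cofactor !det_mx11 !mxE/=.
rewrite (_ : lift 0 0 = 1); last exact/val_inj.
rewrite (_ : lift 1 0 = 0); last exact/val_inj.
by rewrite expr0 expr1 mul1r mulN1r mulrN.
Qed.

(** The characteristic polynomial of [F^T *m F] depends only on its trace, the sum of the squared
    entries of [F], and on its determinant [\det F ^+ 2]. *)
Lemma singular_values2I (R : realType) (F : 'M[R]_2) (l1 l2 : R) :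
  0 <= l1 -> 0 <= l2 ->
  l1 ^+ 2 + l2 ^+ 2 = F 0 0 ^+ 2 + F 0 1 ^+ 2 + F 1 0 ^+ 2 + F 1 1 ^+ 2 ->
  l1 * l2 = \det F -> singular_values2 F l1 l2.
Proof.
move=> l10 l20 lS; rewrite det_mx2 => lM; split=> //.
rewrite /char_poly det_mx2 !mxE !sum_ord2 !mxE /=.
rewrite !mulr1n !mulr0n.
set a := F 0 0 * F 0 0 + _; set b := F 0 0 * F 0 1 + _.
set c := F 0 1 * F 0 0 + _; set d := F 0 1 * F 0 1 + _.
have -> : ('X - (l1 ^+ 2)%:P) * ('X - (l2 ^+ 2)%:P) =
  'X ^+ 2 - (l1 ^+ 2 + l2 ^+ 2)%:P * 'X + ((l1 * l2) ^+ 2)%:P :> {poly R}.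
  by rewrite exprMn !polyCM polyCD; ring.
have -> : l1 ^+ 2 + l2 ^+ 2 = a + d by rewrite lS /a /d; ring.
have -> : (l1 * l2) ^+ 2 = a * d - b * c by rewrite lM /a /b /c /d; ring.
clearbody a b c d; rewrite polyCB !polyCM polyCD; ring.
Qed.

Definition diag2 (R : realType) (a b : R) : 'M[R]_2 :=
  diag_mx (\row_i (if i == 0 then a else b)).

Lemma diag2E (R : realType) (a b : R) :
  [/\ diag2 a b 0 0 = a, diag2 a b 0 1 = 0,
      diag2 a b 1 0 = 0 & diag2 a b 1 1 = b].
Proof. by split; rewrite !mxE/= ?mulr1n ?mulr0n. Qed.

Lemma det_diag2 (R : realType) (a b : R) : \det (diag2 a b) = a * b.
Proof. by rewrite det_mx2; have [-> -> -> ->] := diag2E a b; rewrite mul0r subr0. Qed.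

Lemma singular_values_diag2 (R : realType) (a b : R) :
  0 <= a -> 0 <= b -> singular_values2 (diag2 a b) a b.
Proof.
move=> a0 b0; apply: singular_values2I => //; last by rewrite det_diag2.
by have [-> -> -> ->] := diag2E a b; ring.
Qed.

Lemma posdefmx_diag2 (R : realType) (a b : R) :
  0 < a -> 0 < b -> posdefmx (diag2 a b).
Proof.
move=> a0 b0; split.
  by apply: matrix2P; rewrite !mxE.
move=> x x0; rewrite !(mxE, sum_ord2)/= !mulr1n !mulr0n !mulr0 addr0 add0r.
have : 0 <= x 0 0 ^+ 2 by exact: sqr_ge0.
have : 0 <= x 1 0 ^+ 2 by exact: sqr_ge0.
rewrite le_eqVlt => /predU1P[x1|x1].
  rewrite le_eqVlt => /predU1P[x2|x2]; last by nra.
  move: x1 x2 => /esym/eqP; rewrite sqrf_eq0 => /eqP x1 /esym/eqP.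
  rewrite sqrf_eq0 => /eqP x2; case/negP: x0; apply/eqP/matrixP => i j.
  by rewrite mxE (ord1 j); case: i => -[|[|//]] ?;
    [rewrite -[RHS]x2|rewrite -[RHS]x1]; congr (x _ _); exact/val_inj.
by move=> x2; nra.
Qed.

(** [sqrtm] is a choice, so uniqueness is what matters: the off-diagonal entry of [U *m U] is
    [U 0 1 * (U 0 0 + U 1 1)], and a positive trace forces [U] to be diagonal. *)
Lemma sqrtm_diag2 (R : realType) (a b : R) : 0 < a -> 0 < b ->
  sqrtm ((diag2 a b)^T *m diag2 a b) = diag2 a b.
Proof.
move=> a0 b0; have pd := posdefmx_diag2 a0 b0; have [tr _] := pd.
(* The default value [0] is excluded because [diag2 a b] itself is a root. *)
rewrite /sqrtm tr; case: xgetP => [U _ [[Us Upos] UU]|/(_ (diag2 a b))[]//].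
have [e00 e01 e10 e11] := diag2E a b.
have U10 : U 1 0 = U 0 1 by rewrite -{1}Us mxE.
have U00 : 0 < U 0 0.
  have := Upos (delta_mx 0 0); rewrite !(mxE, sum_ord2)/=.
  rewrite !(mulr1, mul1r, mulr0, mul0r, addr0, add0r); apply.
  by apply/eqP => /matrixP/(_ 0 0); rewrite !mxE/= => /eqP; rewrite oner_eq0.
have U11 : 0 < U 1 1.
  have := Upos (delta_mx 1 0); rewrite !(mxE, sum_ord2)/=.
  rewrite !(mulr1, mul1r, mulr0, mul0r, addr0, add0r); apply.
  by apply/eqP => /matrixP/(_ 1 0); rewrite !mxE/= => /eqP; rewrite oner_eq0.
have H i j := congr1 (fun M : 'M[R]_2 => M i j) UU.
have := H 0 1; rewrite !(mxE, sum_ord2)/= ?e00 ?e01 ?e10 ?e11 => H01.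
have := H 0 0; rewrite !(mxE, sum_ord2)/= => H00.
have := H 1 1; rewrite !(mxE, sum_ord2)/= => H11.
have U01 : U 0 1 = 0.
  apply: (mulIf (_ : U 0 0 + U 1 1 != 0)); first by rewrite gt_eqF// addr_gt0.
  move: H01; rewrite !mulr1n !mulr0n; lra.
apply: matrix2P; rewrite ?U10 ?U01 ?e00 ?e01 ?e10 ?e11 //.
  apply/eqP; rewrite -(eqrXn2 (ltn0Sn 1)) ?ltW//; apply/eqP.
  by move: H00; rewrite U10 U01 !mulr1n !mulr0n; lra.
apply/eqP; rewrite -(eqrXn2 (ltn0Sn 1)) ?ltW//; apply/eqP.
by move: H11; rewrite U10 U01 !mulr1n !mulr0n; lra.
Qed.

Lemma logm_diag2 (R : realType) (a b : R) : 0 < a -> 0 < b ->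
  logm (diag2 a b) = diag2 (ln a) (ln b).
Proof.
move=> a0 b0; have L : is_logm (diag2 a b) (diag2 (ln a) (ln b)).
  exists 1%:M, (\row_i (if i == 0 then a else b)); split.
  - by rewrite trmx1 mulmx1.
  - by move=> i; rewrite mxE; case: ifP.
  - by rewrite trmx1 mulmx1 mul1mx.
  - rewrite trmx1 mulmx1 mul1mx; congr diag_mx.
    by apply/rowP => i; rewrite !mxE; case: ifP.
rewrite /logm; case: xgetP => [L' _ /= L'P|/(_ (diag2 (ln a) (ln b)))[]//].
exact: is_logm_uniq L'P L.
Qed.

Lemma frobenius_dev2_diag2 (R : realType) (a b : R) :
  frobenius_norm (dev2 (diag2 a b)) ^+ 2 = (a - b) ^+ 2 / 2.
Proof.
rewrite /frobenius_norm sqr_sqrtr; last first.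
  by apply: sumr_ge0 => i _; apply: sumr_ge0 => j _; exact: sqr_ge0.
rewrite /dev2 !sum_ord2 !mxE /mxtrace !sum_ord2 !mxE/= !mulr1n !mulr0n.
by field.
Qed.

(** * Closed formulas for the singular values *)

Definition hypot (R : realType) (x y : R) : R := Num.sqrt (x ^+ 2 + y ^+ 2).

Lemma sqr_hypot (R : realType) (x y : R) : hypot x y ^+ 2 = x ^+ 2 + y ^+ 2.
Proof. by rewrite sqr_sqrtr// addr_ge0 ?sqr_ge0. Qed.

(** The triangle inequality in the plane, by way of Cauchy-Schwarz. *)
Lemma hypot_sublinear (R : realType) (s t x y x' y' : R) : 0 <= s -> 0 <= t ->
  hypot (s * x + t * x') (s * y + t * y') <= s * hypot x y + t * hypot x' y'.
Proof.
move=> s0 t0; set p := hypot x y; set q := hypot x' y'.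
have p0 : 0 <= p by exact: sqrtr_ge0.
have q0 : 0 <= q by exact: sqrtr_ge0.
have p2 : p ^+ 2 = x ^+ 2 + y ^+ 2 by exact: sqr_hypot.
have q2 : q ^+ 2 = x' ^+ 2 + y' ^+ 2 by exact: sqr_hypot.
have cauchy : x * x' + y * y' <= p * q.
  case: (lerP (x * x' + y * y') 0) => [?|/ltW X0].
    by apply: le_trans (mulr_ge0 p0 q0).
  rewrite -ler_sqr ?nnegrE ?mulr_ge0// exprMn p2 q2.
  (* Lagrange's identity: this square is the gap between the squared sides. *)
  have := sqr_ge0 (x * y' - y * x'); lra.
have pq0 : 0 <= s * p + t * q by rewrite addr_ge0// mulr_ge0.
rewrite -(ger0_norm pq0) -sqrtr_sqr ler_wsqrtr//.
have := ler_wpM2l (mulr_ge0 s0 t0) cauchy.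
have -> : (s * p + t * q) ^+ 2 =
  s ^+ 2 * p ^+ 2 + t ^+ 2 * q ^+ 2 + 2 * (s * t * (p * q)) by ring.
rewrite p2 q2; lra.
Qed.

(* The two terms are the norms of the conformal and anticonformal parts of F, up
   to a common factor: they are l1 + l2 and l1 - l2 when det F > 0. *)
Definition sv_max (R : realType) (F : 'M[R]_2) : R :=
  (hypot (F 0 0 + F 1 1) (F 0 1 - F 1 0) +
   hypot (F 0 0 - F 1 1) (F 0 1 + F 1 0)) / 2.

(** It carries the sign of [\det F], so that its product with [sv_max] is [\det F] and not the
    absolute value. *)
Definition sv_min (R : realType) (F : 'M[R]_2) : R :=
  (hypot (F 0 0 + F 1 1) (F 0 1 - F 1 0) -
   hypot (F 0 0 - F 1 1) (F 0 1 + F 1 0)) / 2.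

Lemma sv_max_ge0 (R : realType) (F : 'M[R]_2) : 0 <= sv_max F.
Proof. by rewrite divr_ge0// addr_ge0// sqrtr_ge0. Qed.

(** A difference of squares: those of the two [hypot] terms differ by [4 * \det F]. *)
Lemma sv_maxM_min (R : realType) (F : 'M[R]_2) : sv_max F * sv_min F = \det F.
Proof.
have p2 := sqr_hypot (F 0 0 + F 1 1) (F 0 1 - F 1 0).
have q2 := sqr_hypot (F 0 0 - F 1 1) (F 0 1 + F 1 0).
rewrite /sv_max /sv_min det_mx2; move: (hypot _ _) p2 (hypot _ _) q2.
by move=> p p2 q q2; nra.
Qed.

Lemma sv_max_gt0 (R : realType) (F : 'M[R]_2) : GLp2 F -> 0 < sv_max F.
Proof.
rewrite /GLp2 -sv_maxM_min => F0; rewrite lt_neqAle sv_max_ge0 andbT.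
by apply/eqP => E; move: F0; rewrite -E mul0r ltxx.
Qed.

Lemma sv_min_gt0 (R : realType) (F : 'M[R]_2) : GLp2 F -> 0 < sv_min F.
Proof.
by move=> F0; rewrite -(pmulr_rgt0 _ (sv_max_gt0 F0)) sv_maxM_min.
Qed.

Lemma sv_min_le_max (R : realType) (F : 'M[R]_2) : sv_min F <= sv_max F.
Proof.
rewrite ler_pM2r ?invr_gt0// lerD2l.
by apply: (@le_trans _ _ 0); rewrite ?oppr_le0 sqrtr_ge0.
Qed.

Lemma singular_values_sv (R : realType) (F : 'M[R]_2) :
  GLp2 F -> singular_values2 F (sv_max F) (sv_min F).
Proof.
move=> F0; apply: singular_values2I; rewrite ?sv_maxM_min ?sv_max_ge0//.
  exact: ltW (sv_min_gt0 F0).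
have p2 := sqr_hypot (F 0 0 + F 1 1) (F 0 1 - F 1 0).
have q2 := sqr_hypot (F 0 0 - F 1 1) (F 0 1 + F 1 0).
rewrite /sv_max /sv_min; move: (hypot _ _) p2 (hypot _ _) q2.
by move=> p p2 q q2; nra.
Qed.

Lemma sv_ratio (R : realType) (F : 'M[R]_2) : GLp2 F ->
  sv_max F / sv_min F = sv_max F ^+ 2 / \det F.
Proof.
move=> F0; have := sv_max_gt0 F0; have := sv_min_gt0 F0.
by rewrite -sv_maxM_min => m0 M0; field; rewrite !gt_eqF.
Qed.

(** [sv_max] is half the sum of two Euclidean norms of linear images of the matrix. *)
Lemma sv_max_sublinear (R : realType) (s t : R) (F G : 'M[R]_2) :
  0 <= s -> 0 <= t -> sv_max (s *: F + t *: G) <= s * sv_max F + t * sv_max G.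
Proof.
move=> s0 t0; rewrite /sv_max !mxE.
have := hypot_sublinear (F 0 0 + F 1 1) (F 0 1 - F 1 0)
  (G 0 0 + G 1 1) (G 0 1 - G 1 0) s0 t0.
have := hypot_sublinear (F 0 0 - F 1 1) (F 0 1 + F 1 0)
  (G 0 0 - G 1 1) (G 0 1 + G 1 0) s0 t0.
have E (a b c d : R) : s * (a + b) + t * (c + d) = s * a + t * c + (s * b + t * d).
  by ring.
rewrite !E !mulrN !opprD; lra.
Qed.

(** * Polyconvexity and rank-one convexity *)

(** Joint convexity of the perspective of the square: the gap is an explicit square over a positive
    denominator. *)
Lemma sqr_over_convex (R : realType) (s t x y d e : R) :
  0 <= s -> 0 <= t -> 0 < d -> 0 < e -> 0 < s * d + t * e ->
  (s * x + t * y) ^+ 2 / (s * d + t * e) <= s * (x ^+ 2 / d) + t * (y ^+ 2 / e).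
Proof.
move=> s0 t0 d0 e0 z0; rewrite -subr_ge0.
have -> : s * (x ^+ 2 / d) + t * (y ^+ 2 / e) -
    (s * x + t * y) ^+ 2 / (s * d + t * e) =
  s * t * (x * e - y * d) ^+ 2 / (d * e * (s * d + t * e)).
  by field; rewrite !gt_eqF.
apply: divr_ge0; last by rewrite !mulr_ge0// ltW.
by rewrite mulr_ge0 ?sqr_ge0// mulr_ge0.
Qed.

Lemma polyconvex_of_sv_ratio (R : realType) (W : 'M[R]_2 -> R) (k : R -> R) :
  (forall F, GLp2 F -> W F = k (sv_max F ^+ 2 / \det F)) ->
  {homo k : x y / x <= y} ->
  (forall x y t, 0 <= t <= 1 ->
    k (t * x + (1 - t) * y) <= t * k x + (1 - t) * k y) ->
  polyconvex W.
Proof.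
move=> WE kmono kconv.
(* The value [+oo] off the convex set [0 < z.2] preserves convexity. *)
exists (fun z : 'M[R]_2 * R^o =>
  if 0 < z.2 then (k (sv_max z.1 ^+ 2 / z.2))%:E else +oo%E); last first.
  by move=> F F0 /=; rewrite ifT// WE.
split=> [z|[F d] [G e] t t01]; first by case: ifP.
(* The weights 0 and 1 are treated apart because [0 * +oo = 0]; for the others, one infinite value
   makes the right-hand side [+oo]. *)
have [->|tN0] := eqVneq t 0.
  by rewrite scale0r add0r subr0 scale1r mul0e add0e mul1e.
have [->|tN1] := eqVneq t 1.
  by rewrite subrr scale0r addr0 scale1r mul0e adde0 mul1e.
have /andP[t0 t1] := t01.
have t0' : 0 < t by rewrite lt_neqAle eq_sym tN0.
have t1' : 0 < 1 - t by rewrite subr_gt0 lt_neqAle tN1.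
rewrite /=; case: (ltP 0 d) => d0; last first.
  by rewrite gt0_muley ?lte_fin// addye ?leey//; case: ifP => _;
    [rewrite -EFinM|rewrite gt0_muley ?lte_fin].
case: (ltP 0 e) => e0; last first.
  by rewrite gt0_muley ?lte_fin// -EFinM addey ?leey.
have z0 : 0 < t * d + (1 - t) * e by rewrite addr_gt0// mulr_gt0.
rewrite ifT; last exact: z0.
rewrite -!EFinM -EFinD lee_fin; apply: le_trans (kconv _ _ _ t01).
apply/kmono; apply: le_trans (sqr_over_convex _ _ t0 (ltW t1') d0 e0 z0).
rewrite ler_pM2r ?invr_gt0// ler_sqr ?nnegrE ?sv_max_ge0//.
  exact: sv_max_sublinear t0 (ltW t1').
by rewrite addr_ge0// mulr_ge0 ?sv_max_ge0// ltW.
Qed.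

(** The determinant is affine in [t], since its quadratic coefficient is
    [\det (xi *m eta^T) = 0]. *)
Lemma det_rank_one_line (R : realType) (F : 'M[R]_2) (xi eta : 'cV[R]_2) (t : R) :
  \det (F + t *: (xi *m eta^T)) =
  (1 - t) * \det F + t * \det (F + xi *m eta^T).
Proof.
rewrite !det_mx2 !mxE !big_ord1 !mxE; ring.
Qed.

(** By [det_rank_one_line], the pair [(F, \det F)] moves along a straight segment, on which [P] is
    convex. *)
Lemma polyconvex_rank_one_convex (R : realType) (W : 'M[R]_2 -> R) :
  polyconvex W -> rank_one_convex W.
Proof.
move=> [P [_ Pc] PW] F xi eta th F0 th01 line.
have F1 : GLp2 (F + xi *m eta^T).
  by have := line 1; rewrite scale1r; apply; rewrite ler01 lexx.
have /andP[th0 th1] := th01.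
have Fth : GLp2 (F + (1 - th) *: (xi *m eta^T)).
  by apply: line; lra.
have := Pc (F, \det F : R^o) (F + xi *m eta^T, \det (F + xi *m eta^T) : R^o) th th01.
rewrite -!PW// -!EFinM -EFinD -lee_fin; apply: le_trans.
rewrite PW// det_rank_one_line subKr le_eqVlt; apply/orP; left; apply/eqP.
have -> // : F + (1 - th) *: (xi *m eta^T) =
  th *: F + (1 - th) *: (F + xi *m eta^T).
by rewrite scalerDr addrA -scalerDl (addrC th) subrK scale1r.
Qed.

Lemma rank_one_convex_diag2 (R : realType) (W : 'M[R]_2 -> R) (x y t : R) :
  rank_one_convex W -> 0 < x -> 0 < y -> 0 <= t <= 1 ->
  W (diag2 (x + t * (y - x)) 1) <= (1 - t) * W (diag2 x 1) + t * W (diag2 y 1).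
Proof.
move=> rc x0 y0 /andP[t0 t1].
have line s : diag2 x 1 + s *: ((y - x) *: delta_mx 0 0 *m (delta_mx 0 0 : 'cV[R]_2)^T)
    = diag2 (x + s * (y - x)) 1.
  apply: matrix2P; rewrite !(mxE, big_ord1)/= ?mulr1n ?mulr0n; ring.
(* The weight is [1 - t] because [rank_one_convex] puts [theta] on the starting matrix. *)
have := rc (diag2 x 1) ((y - x) *: delta_mx 0 0) (delta_mx 0 0) (1 - t).
rewrite subKr line -[_ *m _]scale1r line mul1r (addrC x (y - x)) subrK; apply.
- by rewrite /GLp2 det_diag2 mulr1.
- by lra.
- move=> s /andP[s0 s1]; rewrite scale1r line /GLp2 det_diag2 mulr1.
  have [->|sN1] := eqVneq s 1; first lra.
  have s1' : 0 < 1 - s by rewrite subr_gt0 lt_neqAle sN1.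
  have := mulr_gt0 s1' x0; have := mulr_ge0 s0 (ltW y0); lra.
Qed.

(** * The energy in terms of the profile, and the equivalences *)

(** Clamping leaves the value unchanged, since the ratio of [sv_max F] to [sv_min F] is at least
    1. *)
Lemma log2_profile_sv (R : realType) (W : 'M[R]_2 -> R) (f : R -> R) (F : 'M[R]_2) :
  (forall F (l1 l2 : R), GLp2 F -> singular_values2 F l1 l2 ->
    W F = f (ln (l1 / l2) ^+ 2)) ->
  GLp2 F -> W F = log2_profile f (Num.max (sv_max F ^+ 2 / \det F) 1).
Proof.
move=> Wf F0; rewrite (Wf _ _ _ F0 (singular_values_sv F0)) -sv_ratio// max_l//.
by rewrite ler_pdivlMr ?sv_min_gt0// mul1r sv_min_le_max.
Qed.

Lemma log2_profile_diag2 (R : realType) (W : 'M[R]_2 -> R) (f : R -> R) (x : R) :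
  (forall F (l1 l2 : R), GLp2 F -> singular_values2 F l1 l2 ->
    W F = f (ln (l1 / l2) ^+ 2)) ->
  0 < x -> W (diag2 x 1) = log2_profile f x.
Proof.
move=> Wf x0; rewrite (Wf _ x 1) ?divr1//; first by rewrite /GLp2 det_diag2 mulr1.
exact: singular_values_diag2 (ltW x0) ler01.
Qed.

(** Both representations are evaluated at [diag2 (expR (Num.sqrt s)) 1], whose squared logarithmic
    ratio is [s]. *)
Lemma dev_log_energy_half (R : realType) (W : 'M[R]_2 -> R) (f ft : R -> R) (s : R) :
  (forall F (l1 l2 : R), GLp2 F -> singular_values2 F l1 l2 ->
    W F = f (ln (l1 / l2) ^+ 2)) ->
  (forall F, GLp2 F ->
    W F = ft (frobenius_norm (dev2 (logm (sqrtm (F^T *m F)))) ^+ 2)) ->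
  0 <= s -> f s = ft (s / 2).
Proof.
move=> Wf Wft s0; pose x := expR (Num.sqrt s); have x0 : 0 < x := expR_gt0 _.
have := log2_profile_diag2 Wf x0.
rewrite Wft; last by rewrite /GLp2 det_diag2 mulr1.
rewrite sqrtm_diag2// logm_diag2// frobenius_dev2_diag2 ln1 subr0.
by rewrite /log2_profile expRK sqr_sqrtr.
Qed.

Unset Implicit Arguments.

Theorem proposition4p2 (R : realType) (W : 'M[R]_2 -> R) (f ft : R -> R)
    (W_objective_isotropic : objective_isotropic W)
    (W_isochoric : isochoric W)
    (W_ft : forall F, GLp2 F ->
      W F = ft (frobenius_norm (dev2 (logm (sqrtm (F^T *m F)))) ^+ 2))
    (W_f : forall F (l1 l2 : R), GLp2 F -> singular_values2 F l1 l2 ->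
      W F = f (ln (l1 / l2) ^+ 2))
    (f_C2 : C2_ge0 f) (ft_C2 : C2_ge0 ft) :
  [<-> polyconvex W;
       rank_one_convex W;
       forall theta : R, 0 < theta ->
         0 <= 2 * theta * f^`(2)%classic theta
              + (1 - Num.sqrt theta) * f^`()%classic theta;
       forall eta : R, 0 < eta ->
         0 <= 2 * eta * ft^`(2)%classic eta
              + (1 - Num.sqrt (2 * eta)) * ft^`()%classic eta].
Proof.
case: f_C2 => f1 [f2 [ff1 f12 _]]; case: ft_C2 => g1 [g2 [gg1 g12 _]].
have fg0 x : 0 < x -> f x = 1 * ft (x / 2).
  by move=> /ltW x0; rewrite mul1r (dev_log_energy_half W_f W_ft).
have fg1 := is_derive_ge0_half ff1 gg1 fg0.
have fg2 := is_derive_ge0_half f12 g12 fg1.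
(* Condition (iii) at [2 * eta] is half of (iv) at [eta]: there [f1] is [g1 eta / 2] and [f2] is
   [g2 eta / 4]. *)
have fgcond eta : 0 < eta ->
    2 * (2 * eta) * f2 (2 * eta) + (1 - Num.sqrt (2 * eta)) * f1 (2 * eta) =
    (2 * eta * ft^`(2)%classic eta + (1 - Num.sqrt (2 * eta)) * ft^`()%classic eta) / 2.
  move=> eta0; rewrite fg1 ?fg2 ?mulr_gt0// (mulrC 2 eta) mulfK//.
  by rewrite (is_derive_ge0_derive1 gg1 eta0) (is_derive_ge0_derive2 gg1 g12 eta0); field.
tfae.
- exact: polyconvex_rank_one_convex.
- move=> rc theta theta0.
  rewrite (is_derive_ge0_derive1 ff1 theta0) (is_derive_ge0_derive2 ff1 f12 theta0).
  apply: convex_log2_profile ff1 f12 _ theta0 => y z t y0 z0 t01.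
  have w0 : 0 < y + t * (z - y).
    have /andP[t0 t1] := t01; have [->|tN1] := eqVneq t 1; first lra.
    have t1' : 0 < 1 - t by rewrite subr_gt0 lt_neqAle tN1.
    have := mulr_gt0 t1' y0; have := mulr_ge0 t0 (ltW z0); lra.
  by rewrite -!(log2_profile_diag2 W_f)//; exact: rank_one_convex_diag2.
- move=> cond eta eta0; have e20 : 0 < 2 * eta by rewrite mulr_gt0.
  have := cond _ e20.
  rewrite (is_derive_ge0_derive1 ff1 e20) (is_derive_ge0_derive2 ff1 f12 e20).
  by rewrite fgcond// pmulr_lge0.
- move=> cond.
  have [theta theta0|kmono kconv] := log2_profile_clamp ff1 f12.
    (* Using (iv) at [theta / 2] recovers (iii) at [theta], as the clamping lemma requires. *)
    have th20 : 0 < theta / 2 by rewrite divr_gt0.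
    have := fgcond _ th20; have := cond _ th20.
    rewrite [2 * (theta / 2)]mulrC divfK// => c0 ->.
    by rewrite pmulr_lge0.
  by apply: (polyconvex_of_sv_ratio _ kmono kconv) => F; exact: log2_profile_sv.
Qed.
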